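(* Let $A$ be a commutative ring with identity and $HA$ the ring of Hurwitz series over $A$. Let $n\in\mathbb{N}^+$, $f\in HA$ and $z_0,\dots,z_{n-1}\in HA$. Then $$f\cdot\mathrm{intl}(z_0,\dots,z_{n-1})=\mathrm{intl}(h_0,\dots,h_{n-1}),$$ where for each $0\le i\le n-1$, $$h_i=\sum_{k\in\mathbb{N},\ i<\overline{k}}\int^{\widehat{k}+1}f(k)\,C^{n-\overline{k}+k+i}_{k,n}\boxdot z_{n-\overline{k}+i}\;+\;\sum_{k\in\mathbb{N},\ i\ge\overline{k}}\int^{\widehat{k}}f(k)\,C^{i-\overline{k}+k}_{k,n}\boxdot z_{i-\overline{k}},$$ with $\widehat{k}=\lfloor k/n\rfloor$, $\overline{k}=k-\widehat{k}n$, and the infinite sums taken componentwise (each component is a finite sum).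
   Context: $HA$ is the set of sequences $f=(f(0),f(1),\dots)$ with entries in $A$, with componentwise addition and product $(fg)(m)=\sum_{i=0}^m\binom{m}{i}f(i)g(m-i)$; scalar multiplication by $a\in A$ is componentwise. The integral is $\int f=(0,f(0),f(1),\dots)$, $\int^m$ its $m$-fold iterate ($\int^0=\mathrm{id}$). For fixed $n\in\mathbb{N}^+$ and $m\in\mathbb{N}$, $\widehat{m}=\lfloor m/n\rfloor$, $\overline{m}=m-\widehat{m}n$. The interlacing $\mathrm{intl}(z_0,\dots,z_{n-1})\in HA$ is given by $\mathrm{intl}(z_0,\dots,z_{n-1})(m)=z_{\overline{m}}(\widehat{m})$. The Hadamard product is $(f\boxdot g)(p)=f(p)g(p)$. For $\ell,k\in\mathbb{N}$, $C^{\ell}_{k,n}\in HA$ is defined by $C^{\ell}_{k,n}(p)=\binom{\ell+pn}{k}$ (with $\binom{a}{b}=0$ if $a<b$). *)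

(* Defs.v *)
From HB Require Import structures.
From mathcomp Require Import all_boot all_algebra.
From mathcomp Require Import ring.
From mathcomp Require Import boolp classical_sets functions cardinality fsbigop.

Set Implicit Arguments.
Unset Strict Implicit.
Unset Printing Implicit Defensive.

Import GRing.Theory.
Local Open Scope classical_set_scope.
Local Open Scope ring_scope.

(* An alias of [nat -> A], so that the ring structure declared below does not
   clash with the pointwise product that [functions] puts on [nat -> A]. *)
Definition hurwitz (A : Type) : Type := nat -> A.

HB.instance Definition _ (A : zmodType) :=
  GRing.Zmodule.copy (hurwitz A) (nat -> A).

Section HurwitzRing.
Variable A : comPzRingType.
Implicit Types f g h : hurwitz A.

Lemma haddE f g m : (f + g) m = f m + g m.
Proof. by []. Qed.

Definition hmul f g : hurwitz A :=
  fun m => \sum_(i < m.+1) f i * g (m - i)%N *+ 'C(m, i).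

Definition hone : hurwitz A := fun m => (m == 0)%:R.

Definition hscale (a : A) f : hurwitz A := fun m => a * f m.

Fact hmulC : commutative hmul.
Proof.
move=> f g; apply: funext => m; rewrite /hmul (reindex_inj rev_ord_inj) /=.
apply: eq_bigr => i _; rewrite subSS bin_sub -1?ltnS // subKn -1?ltnS //.
by rewrite mulrC.
Qed.

Fact hmul1 : left_id hone hmul.
Proof.
move=> f; apply: funext => m; rewrite /hmul big_ord_recl /hone /= mul1r bin0.
by rewrite subn0 big1 ?addr0 // => i _; rewrite mul0r mul0rn.
Qed.

Fact hmulDl : left_distributive hmul +%R.
Proof.
move=> f g h; apply: funext => m; rewrite haddE /hmul -big_split /=.
by apply: eq_bigr => i _; rewrite mulrDl mulrnDl.
Qed.

Let bin_bin m i j : (i + j <= m)%N ->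
  ('C(m, i) * 'C(m - i, j) = 'C(m, j) * 'C(m - j, i))%N.
Proof.
move=> le_ij; apply/eqP.
rewrite -(@eqn_pmul2r (i`! * j`! * (m - i - j)`!)) ?muln_gt0 ?fact_gt0 //.
have e1 : ('C(m - i, j) * (j`! * (m - i - j)`!) = (m - i)`!)%N.
  by apply: bin_fact; rewrite leq_subRL // (leq_trans _ le_ij) ?leq_addr.
have e2 : ('C(m - j, i) * (i`! * (m - j - i)`!) = (m - j)`!)%N.
  by apply: bin_fact; rewrite leq_subRL 1?addnC // (leq_trans _ le_ij) ?leq_addl.
have e3 : ('C(m, i) * (i`! * (m - i)`!) = m`!)%N.
  by apply: bin_fact; rewrite (leq_trans _ le_ij) ?leq_addr.
have e4 : ('C(m, j) * (j`! * (m - j)`!) = m`!)%N.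
  by apply: bin_fact; rewrite (leq_trans _ le_ij) ?leq_addl.
apply/eqP; transitivity (m`!); first by rewrite -e3 -e1; ring.
by rewrite -e4 -e2 subnAC; ring.
Qed.

Fact hmulA : associative hmul.
Proof.
move=> f g h; rewrite [RHS]hmulC (hmulC g).
apply: funext => m.
pose t i j := f i * (h j * g (m - i - j)%N) *+ ('C(m, i) * 'C(m - i, j)).
transitivity (\sum_(i < m.+1) \sum_(j < m.+1 | (j <= m - i)%N) t i j).
  apply: eq_bigr => i _; rewrite (big_ord_narrow_leq (leq_subr _ _)) /=.
  rewrite /hmul big_distrr -sumrMnl /=; apply: eq_bigr => j _.
  by rewrite /t mulrnA mulrnAr mulrnAC.
rewrite (exchange_big_dep predT) //=; apply: eq_bigr => j _.
transitivity (\sum_(i < m.+1 | (i <= m - j)%N) t i j).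
  apply: eq_bigl => i; rewrite !leq_subRL ?leq_ord //.
  by rewrite addnC.
rewrite (big_ord_narrow_leq (leq_subr _ _)) /= /hmul big_distrr -sumrMnl /=.
apply: eq_bigr => i _; rewrite /t bin_bin; last first.
  by rewrite addnC -leq_subRL ?leq_ord.
by rewrite mulrnA mulrnAr mulrnAC subnAC mulrCA.
Qed.

HB.instance Definition _ :=
  GRing.Zmodule_isComPzRing.Build (hurwitz A) hmulA hmulC hmul1 hmulDl.

Fact hscaleA (a b : A) f : hscale a (hscale b f) = hscale (a * b) f.
Proof. by apply: funext => m; rewrite /hscale mulrA. Qed.

Fact hscale1 : left_id 1 hscale.
Proof. by move=> f; apply: funext => m; rewrite /hscale mul1r. Qed.

Fact hscaleDr : right_distributive hscale +%R.
Proof. by move=> a f g; apply: funext => m; rewrite /hscale mulrDr. Qed.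

Fact hscaleDl f : {morph hscale^~ f : a b / a + b}.
Proof. by move=> a b; apply: funext => m; rewrite /hscale mulrDl. Qed.

HB.instance Definition _ := GRing.Zmodule_isLmodule.Build A (hurwitz A)
  hscaleA hscale1 hscaleDr hscaleDl.

Lemma hmulE f g m :
  (f * g) m = \sum_(i < m.+1) 'C(m, i)%:R * f i * g (m - i)%N.
Proof. by apply: eq_bigr => i _; rewrite -mulrA mulr_natl. Qed.

Lemma hscaleE a f m : (a *: f) m = a * f m.
Proof. by []. Qed.

Definition hint f : hurwitz A := fun m => if m is p.+1 then f p else 0.

Definition hadamard f g : hurwitz A := fun p => f p * g p.

(* [m %/ n] and [m %% n] are the paper's \widehat{m} and \overline{m}; the
   default value of [nth] is never used when [0 < n]. *)
Definition intl n (z : n.-tuple (hurwitz A)) : hurwitz A :=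
  fun m => z`_(m %% n) (m %/ n)%N.

Definition hbin (l k n : nat) : hurwitz A := fun p => 'C(l + p * n, k)%:R.

Definition locally_finite (D : set nat) (g : nat -> hurwitz A) : Prop :=
  forall p, finite_set [set k | D k /\ g k p != 0].

(* The componentwise sum of [g] over [D]; each component is the library's
   finite-support sum, which is meaningful when [locally_finite D g]. *)
Definition hsum (D : set nat) (g : nat -> hurwitz A) : hurwitz A :=
  fun p => \sum_(k \in D) g k p.

End HurwitzRing.

Arguments hbin {A}.

(* Main.v *)
(* Write m = i + q * n with i < n.  Subtracting k from m in base n, with a borrow
   exactly when i < k %% n, shows that m - k has last digit i - k %% n and
   quotient q - k %/ n, or n - k %% n + i and q - (k %/ n).+1 when there is a
   borrow.  Hence the k-th summand of h_i at q is the k-th summand of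
   (f * intl z) m, and the two sums of h_i split the latter according to the
   borrow. *)
Require Import Defs.
From mathcomp Require Import all_boot all_algebra.
From mathcomp Require Import zify.
From mathcomp Require Import boolp classical_sets functions cardinality fsbigop.

Set Implicit Arguments.
Unset Strict Implicit.
Unset Printing Implicit Defensive.

Import GRing.Theory.
Local Open Scope classical_set_scope.
Local Open Scope ring_scope.

Section ComponentwiseFormulas.
Variable A : comPzRingType.
Implicit Types g : hurwitz A.

Lemma iter_hintE j g p :
  iter j (@hint A) g p = if (j <= p)%N then g (p - j)%N else 0.
Proof. by elim: j p => [|j IHj] [|p] //=; rewrite IHj. Qed.

(** Bridges the sums of [hsum] and the Hurwitz product: the support of [F] lies in the range
    [0..m]. *)
Lemma fsbig_nat_ord (D : set nat) (F : nat -> A) m :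
  (forall k, (m < k)%N -> F k = 0) ->
  \sum_(k \in D) F k = \sum_(k < m.+1 | (k : nat) \in D) F k.
Proof.
move=> F0; rewrite fsbig_mkcond [RHS]big_mkcond /=.
rewrite -(big_mkord predT (fun k => if k \in D then F k else 0)).
rewrite (fsbigE (index_iota 0 m.+1)) ?iota_uniq //=.
  by apply: eq_big => // k; rewrite in_setT.
move=> k _; rewrite mem_index_iota /= -leqNgt => lt_mk.
by rewrite /patch F0 // if_same.
Qed.

(** [m - k] has last digit [r] and quotient [p], so [intl z] reads [z_r(p)] there, while
    [r + k + p * n = m] turns [hbin] into ['C(m, k)]. *)
Lemma hadamard_hbin_intl n (z : n.-tuple (hurwitz A)) (a : A) k r p m :
  (r < n)%N -> (m = k + (p * n + r))%N ->
  hadamard (a *: hbin (r + k) k n) z`_r p = 'C(m, k)%:R * a * intl z (m - k)%N.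
Proof.
move=> r_lt ->; have n_gt0 : (0 < n)%N by case: n r_lt {z}.
rewrite /hadamard hscaleE /hbin /intl addKn modnMDl divnMDl //.
rewrite modn_small // divn_small // addn0 [a * _]mulrC.
by rewrite [(r + k)%N]addnC addnAC -addnA.
Qed.

(* In the next two lemmas, when [k] exceeds the index [i + q * n] the left side
   vanishes because of the integrals and the right side because of the
   binomial. *)
Lemma iter_hint_hbin_nowrap n (z : n.-tuple (hurwitz A)) (a : A) k i q :
  (i < n)%N -> (k %% n <= i)%N ->
  iter (k %/ n) (@hint A)
    (hadamard (a *: hbin (i - k %% n + k) k n) z`_(i - k %% n)) q =
  'C(i + q * n, k)%:R * a * intl z (i + q * n - k)%N.
Proof.
move=> i_lt le_ki; have k_eq := divn_eq k n.
rewrite iter_hintE; case: leqP => [le_q|lt_q].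
  have le_qn := leq_mul le_q (leqnn n).
  by apply: hadamard_hbin_intl; rewrite ?mulnBl; lia.
by rewrite bin_small ?mul0r //; have := leq_mul lt_q (leqnn n); lia.
Qed.

Lemma iter_hint_hbin_wrap n (z : n.-tuple (hurwitz A)) (a : A) k i q :
  (0 < n)%N -> (i < k %% n)%N ->
  iter (k %/ n).+1 (@hint A)
    (hadamard (a *: hbin (n - k %% n + k + i) k n) z`_(n - k %% n + i)) q =
  'C(i + q * n, k)%:R * a * intl z (i + q * n - k)%N.
Proof.
move=> n_gt0 lt_ik; have k_eq := divn_eq k n; have k_lt := ltn_pmod k n_gt0.
rewrite addnAC iter_hintE; case: ltnP => [lt_q|le_q].
  have lt_qn := leq_mul lt_q (leqnn n).
  by apply: hadamard_hbin_intl; rewrite ?mulnBl; lia.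
(* Even when [q = k %/ n], the borrow [i < k %% n] forces [i + q * n < k]. *)
by rewrite bin_small ?mul0r //; have := leq_mul le_q (leqnn n); lia.
Qed.

End ComponentwiseFormulas.

Theorem theorem3p11 (A : comPzRingType) (n : nat) (n_gt0 : (0 < n)%N)
    (f : hurwitz A) (z : n.-tuple (hurwitz A)) :
  let D1 (i : nat) : set nat := [set k | (i < k %% n)%N] in
  let D2 (i : nat) : set nat := [set k | (k %% n <= i)%N] in
  let g1 (i k : nat) : hurwitz A :=
    iter (k %/ n).+1 (@hint A)
      (hadamard (f k *: hbin (n - k %% n + k + i) k n) z`_(n - k %% n + i)) in
  let g2 (i k : nat) : hurwitz A :=
    iter (k %/ n) (@hint A)
      (hadamard (f k *: hbin (i - k %% n + k) k n) z`_(i - k %% n)) in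
  let h (i : nat) : hurwitz A := hsum (D1 i) (g1 i) + hsum (D2 i) (g2 i) in
  (forall i : 'I_n,
     locally_finite (D1 i) (g1 i) /\ locally_finite (D2 i) (g2 i)) /\
  f * intl z = intl [tuple h i | i < n].
Proof.
move=> D1 D2 g1 g2 h.
(* The [k]-th term of [(f * intl z) m], extended to all [k]; for [m < k] the subtraction truncates,
   but the binomial is zero. *)
pose t m k := 'C(m, k)%:R * f k * intl z (m - k)%N.
have t0 m k : (m < k)%N -> t m k = 0 by move=> ?; rewrite /t bin_small // !mul0r.
have g1E (i : 'I_n) q k : D1 i k -> g1 i k q = t (i + q * n)%N k.
  exact: iter_hint_hbin_wrap.
have g2E (i : 'I_n) q k : D2 i k -> g2 i k q = t (i + q * n)%N k.
  exact: iter_hint_hbin_nowrap.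
(* At component [q], only indices [k <= i + q * n] can contribute. *)
have lf (D : set nat) (g : nat -> hurwitz A) (i : nat) :
    (forall q k, D k -> g k q = t (i + q * n)%N k) -> locally_finite D g.
  move=> gE q; apply: sub_finite_set (finite_II (i + q * n).+1) => k /= [Dk].
  by rewrite gE // ltnS leqNgt; apply: contraNN => /t0 ->.
split=> [i|].
  by split; apply: (lf _ _ i) => q k; [apply: g1E | apply: g2E].
apply: funext => m; rewrite hmulE [RHS]/intl.
pose i := Ordinal (ltn_pmod m n_gt0).
have mE : (i + m %/ n * n = m)%N by rewrite addnC -divn_eq.
have -> : [tuple h i | i < n]`_(m %% n) = h i.
  by rewrite -[(m %% n)%N]/(nat_of_ord i) -tnth_nth tnth_mktuple.
have -> : h i (m %/ n)%N = \sum_(k \in D1 i) t m k + \sum_(k \in D2 i) t m k.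
  rewrite /h haddE; congr (_ + _); apply: eq_fsbigr => k /set_mem Dk.
    by rewrite g1E // mE.
  by rewrite g2E // mE.
rewrite !(fsbig_nat_ord _ (t0 m)).
(* Split the product by borrow; [D2 i] is the complement of [D1 i]. *)
rewrite (bigID (fun k : 'I_m.+1 => (k : nat) \in D1 i)) /=.
congr (_ + _); apply: eq_bigl => k.
by rewrite /D1 /D2 !mem_setE /= -leqNgt.
Qed.
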